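(* Let $a_1,\ldots,a_n$, $b_1,\ldots,b_{n-1}$, $c_1,\ldots,c_{n-1}$ be real numbers with $a_j,b_j,c_j>0$ for $j=1,2,\ldots,n-1$, and let $A_J$ be the anti-tridiagonal $n\times n$ matrix $$ A_{J}= \begin{pmatrix} 0 & 0 &0&\dots& 0 & b_1 & a_1 \\ 0 &0&0&\dots& b_2 & a_2 & c_1 \\ 0 & 0&0&\dots& a_3& c_2& 0 \\ \vdots&\vdots&\vdots&&\vdots&\vdots&\vdots\\ 0&b_{n-2}&a_{n-2}&\dots&0&0&0\\ b_{n-1}&a_{n-1}&c_{n-2}&\dots&0&0&0\\ a_n&c_{n-1}& 0 &\dots&0&0&0 \end{pmatrix}, $$ i.e. $(A_J)_{i,n+1-i}=a_i$ for $1\leqslant i\leqslant n$, $(A_J)_{i,n-i}=b_i$ and $(A_J)_{i+1,n+1-i}=c_i$ for $1\leqslant i\leqslant n-1$, and all other entries are zero. For $k=1,\ldots,n$ let $D_k$ be the determinant of the $k\times k$ matrix of the same form built from $a_1,\ldots,a_k$, $b_1,\ldots,b_{k-1}$, $c_1,\ldots,c_{k-1}$ (equivalently, the minor of $A_J$ formed by rows $1,\ldots,k$ and columns $n-k+1,\ldots,n$): $$ D_k=\begin{vmatrix} 0 & 0 &0&\dots& 0 & b_1 & a_1 \\ 0 &0&0&\dots& b_2 & a_2 & c_1 \\ 0 & 0&0&\dots& a_3& c_2& 0 \\ \vdots&\vdots&\vdots&&\vdots&\vdots&\vdots\\ 0&b_{k-2}&a_{k-2}&\dots&0&0&0\\ b_{k-1}&a_{k-1}&c_{k-2}&\dots&0&0&0\\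 a_k&c_{k-1}& 0 &\dots&0&0&0 \end{vmatrix}. $$ Then $A_J$ is sign definite of class $n^{+}$ and possesses a self-interlacing spectrum if and only if $$(-1)^{\frac{k(k-1)}{2}}D_k>0,\qquad k=1,2,\ldots,n.$$
   Context: A square $n\times n$ matrix is called sign definite of class $n$ if for every $k\leqslant n$ all its nonzero minors of order $k$ have the same sign $\varepsilon_k\in\{1,-1\}$. A sign definite matrix of class $n$ is strictly sign definite of class $n$ if all its minors are different from zero. A sign definite matrix of class $n$ is said to be of class $n^{+}$ if some (positive integer) power of it is a strictly sign definite matrix of class $n$. An $n\times n$ matrix possesses a self-interlacing spectrum if its eigenvalues are real and simple and can be enumerated as $\lambda_1,\ldots,\lambda_n$ so that $\lambda_1>-\lambda_2>\lambda_3>\cdots>(-1)^{n-1}\lambda_n>0$. *)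

(* Defs.v *)
From HB Require Import structures.
From mathcomp Require Import all_boot all_order all_algebra.
From mathcomp Require Import reals.

Set Implicit Arguments.
Unset Strict Implicit.
Unset Printing Implicit Defensive.

Import Order.TTheory GRing.Theory Num.Theory.
Local Open Scope ring_scope.

Definition increasing (k n : nat) (f : 'I_k -> 'I_n) : Prop :=
  forall i j : 'I_k, (i < j)%N -> (f i < f j)%N.

(* Only meant for increasing f and g, which select the rows and the columns. *)
Definition minor (R : realFieldType) (n k : nat) (A : 'M[R]_n)
    (f g : 'I_k -> 'I_n) : R :=
  \det (mxsub f g A).

Definition sign_definite (R : realFieldType) (n : nat) (A : 'M[R]_n) : Prop :=
  forall k : nat, (1 <= k <= n)%N ->
  exists eps : R, (eps = 1 \/ eps = -1) /\
    forall f g : 'I_k -> 'I_n, increasing f -> increasing g ->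
      minor A f g != 0 -> Num.sg (minor A f g) = eps.

Definition strictly_sign_definite (R : realFieldType) (n : nat)
    (A : 'M[R]_n) : Prop :=
  sign_definite A /\
  forall k : nat, (1 <= k <= n)%N ->
    forall f g : 'I_k -> 'I_n, increasing f -> increasing g ->
      minor A f g != 0.

Definition sign_definite_plus (R : realFieldType) (n : nat)
    (A : 'M[R]_n) : Prop :=
  sign_definite A /\
  exists m : nat, (0 < m)%N /\ strictly_sign_definite (A ^+ m).

(* The factorization of the characteristic polynomial says that lam lists all
   the complex eigenvalues of A with multiplicity, hence that they are real;
   injectivity says that they are simple.  Indices start at 0, so that lam i
   is the eigenvalue lambda_(i+1). *)
Definition self_interlacing_spectrum (R : realFieldType) (n : nat)
    (A : 'M[R]_n) : Prop :=
  exists lam : 'I_n -> R,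
    [/\ char_poly A = \prod_(i < n) ('X - (lam i)%:P),
        injective lam,
        forall i j : 'I_n, (i < j)%N ->
          (-1) ^+ i * lam i > (-1) ^+ j * lam j
      & forall i : 'I_n, (-1) ^+ i * lam i > 0].

(* The sequences a, b, c are indexed from 1 (a 0, b 0, c 0 never occur), while
   rows and columns are indexed from 0: row i of the matrix contains a_(i+1)
   on the antidiagonal, b_(i+1) just before it and c_i just after it. *)
Definition anti_tridiagonal (R : realFieldType) (n : nat) (a b c : nat -> R) :
    'M[R]_n :=
  \matrix_(i < n, j < n)
    if (i + j + 1 == n)%N then a i.+1
    else if (i + j + 2 == n)%N then b i.+1
    else if (i + j == n)%N then c i
    else 0.

(* Main.v *)
(* Reversing the columns of A_J gives a tridiagonal matrix T with positive
   off-diagonal entries, and a minor of order k of A_J is (-1)^(k(k-1)/2) times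
   a minor of T.  If the leading minors of T are positive then T = L U with L
   and U nonnegative bidiagonal, so by Cauchy-Binet T is totally nonnegative
   and some even power B of A_J has only positive minors.  The Krylov matrices
   of B and of its transpose at e_0 then have nonnegative minors, so the Hankel
   matrix of the moments (B^m)_(0,0) has positive leading minors and
   p |-> p(B)_(0,0) is positive on squares of polynomials of degree less than
   n.  It vanishes on the multiples of the characteristic polynomial of B, which
   is therefore not divisible by any (X - a)^2 + b^2: the spectrum of B is real
   and simple.  A_J commutes with B, so it is diagonalizable with real
   eigenvalues of distinct moduli.
   The sums of the principal minors of order k of the powers of A_J, dominated
   by powers of lambda_1 ... lambda_k, give the sign of this product.
   Conversely, the minor b_1 ... b_k of T shows that the nonzero minors of T of
   order k < n are positive, and the three-term recurrence for the leading
   minors forbids zeros. *)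

Require Import Defs.
From HB Require Import structures.
From mathcomp Require Import all_boot all_order all_algebra.
From mathcomp Require Import fingroup perm.
From mathcomp Require Import reals complex.
From mathcomp Require Import zify ring lra.

Set Implicit Arguments.
Unset Strict Implicit.
Unset Printing Implicit Defensive.

Import Order.TTheory GRing.Theory Num.Theory.
Local Open Scope ring_scope.

(** * Cauchy-Binet *)

Lemma det_mul_expand (R : comNzRingType) (k n : nat)
    (X : 'M[R]_(k, n)) (Y : 'M[R]_(n, k)) :
  \det (X *m Y) =
  \sum_(f : {ffun 'I_k -> 'I_n}) (\prod_i X i (f i)) * \det (rowsub f Y).
Proof.
rewrite /determinant.
under eq_bigr => s _.
  under eq_bigr => i _ do rewrite mxE.
  rewrite bigA_distr_bigA big_distrr /=.
  over.
rewrite exchange_big; apply: eq_bigr => f _ /=.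
rewrite big_distrr; apply: eq_bigr => s _ /=.
rewrite big_split /= mulrCA; congr (_ * (_ * _)).
by apply: eq_bigr => i _; rewrite mxE.
Qed.

Lemma det_colsub_perm (R : comNzRingType) (k n : nat)
    (X : 'M[R]_(k, n)) (f : 'I_k -> 'I_n) (s : 'S_k) :
  \det (colsub (f \o s) X) = (-1) ^+ s * \det (colsub f X).
Proof.
have -> : colsub (f \o s) X = col_perm s (colsub f X).
  by apply/matrixP => i j; rewrite !mxE.
by rewrite col_permE det_mulmx det_perm odd_permV mulrC.
Qed.

Lemma det_rowsub_perm (R : comNzRingType) (k n : nat)
    (Y : 'M[R]_(n, k)) (f : 'I_k -> 'I_n) (s : 'S_k) :
  \det (rowsub (f \o s) Y) = (-1) ^+ s * \det (rowsub f Y).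
Proof. by rewrite -det_tr trmx_mxsub det_colsub_perm -trmx_mxsub det_tr. Qed.

(* Cauchy-Binet summed over all maps instead of over increasing ones: the maps
   that are not injective contribute 0, and each k-subset is counted k! times. *)
Lemma Cauchy_Binet (R : comNzRingType) (k n : nat)
    (X : 'M[R]_(k, n)) (Y : 'M[R]_(n, k)) :
  k`!%:R * \det (X *m Y) =
  \sum_(f : {ffun 'I_k -> 'I_n}) \det (colsub f X) * \det (rowsub f Y).
Proof.
(* Reindexing the sum by [f |-> f \o s] leaves it unchanged, so every [s] gives the same value.
   Summing over [s] produces [k!] on the left and the Leibniz formula for [\det (colsub f X)] on the
   right. *)
have E (s : 'S_k) : \det (X *m Y) =
    \sum_(f : {ffun 'I_k -> 'I_n})
      (-1) ^+ s * (\prod_i colsub f X i (s i)) * \det (rowsub f Y).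
  rewrite det_mul_expand.
  pose h (f : {ffun 'I_k -> 'I_n}) := [ffun i => f (s i)].
  have hI : injective h.
    move=> f g /ffunP fg; apply/ffunP => i.
    by have := fg ((s^-1)%g i); rewrite !ffunE permKV.
  rewrite (reindex_inj hI); apply: eq_bigr => f _.
  have -> : rowsub (h f) Y = rowsub (f \o s) Y.
    by apply/matrixP => i j; rewrite !mxE ffunE.
  rewrite det_rowsub_perm mulrA [_ * (-1) ^+ s]mulrC; congr (_ * _ * _).
  by apply: eq_bigr => i _; rewrite !mxE ffunE.
transitivity (\sum_(s : 'S_k) \det (X *m Y)).
  by rewrite mulr_natl sumr_const card_Sn.
under eq_bigr => s _ do rewrite (E s).
by rewrite exchange_big; apply: eq_bigr => f _; rewrite -big_distrl.
Qed.

Lemma det_colsub_not_inj (R : comNzRingType) (k n : nat)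
    (X : 'M[R]_(k, n)) (f : 'I_k -> 'I_n) :
  ~~ injectiveb f -> \det (colsub f X) = 0.
Proof.
case/injectivePn => i [j ij fij]; rewrite -det_tr.
by apply: (determinant_alternate ij) => l; rewrite !mxE fij.
Qed.

(** Serves twice: to make index maps increasing, and to order eigenvalues by decreasing modulus. *)
Lemma sort_injective (d : Order.disp_t) (T : orderType d) (k : nat)
    (f : 'I_k -> T) : injective f ->
  exists s : 'S_k, forall i j : 'I_k, (i < j)%N -> (f (s i) < f (s j))%O.
Proof.
move=> fI; pose r := relpre f (<=%O : rel T).
pose t := sort r (enum 'I_k).
have sz : size t == k by rewrite size_sort size_enum_ord.
have tu : uniq t by rewrite sort_uniq enum_uniq.
have nthI : injective (tnth (Tuple sz)).
  move=> i j; rewrite !(tnth_nth i) /= => /eqP.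
  by rewrite nth_uniq ?(eqP sz)// => /eqP/val_inj.
exists (perm nthI) => i j ij; rewrite !permE lt_neqAle (inj_eq fI).
rewrite (inj_eq nthI) -val_eqE ltn_eqF //= !(tnth_nth i) /=.
have r_tr : transitive r by move=> x y z; apply: le_trans.
have : sorted r t by apply: sort_sorted => x y; apply: le_total.
move=> /(sorted_ltn_nth r_tr i); apply=> //; by rewrite inE (eqP sz).
Qed.

Lemma increasing_perm (k n : nat) (f : 'I_k -> 'I_n) : injective f ->
  exists g : 'I_k -> 'I_n, exists s : 'S_k, increasing g /\ f =1 g \o s.
Proof.
move=> fI; have fI' : injective (fun i => nat_of_ord (f i)).
  by move=> i j /val_inj/fI.
have [s sP] := sort_injective fI'.
exists (f \o s), (s^-1)%g; split=> [i j /sP //|i].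
by rewrite /= permKV.
Qed.

Lemma increasing_inj (k n : nat) (f : 'I_k -> 'I_n) :
  increasing f -> injective f.
Proof.
move=> fi i j fij; apply: val_inj.
by case: (ltngtP i j) => // /fi; rewrite fij ltnn.
Qed.

Lemma increasing_leq (k n : nat) (f : 'I_k -> 'I_n) (i j : 'I_k) :
  increasing f -> (f i <= f j)%N = (i <= j)%N.
Proof.
move=> fi; case: (ltngtP i j) => [/fi/ltnW //|/fi|/val_inj ->]; last first.
  exact: leqnn.
by rewrite ltnNge => /negbTE.
Qed.

(** * Minors of products and of bidiagonal matrices *)

Lemma eq_minor (R : realFieldType) (n k : nat) (A : 'M[R]_n)
    (f f' g g' : 'I_k -> 'I_n) :
  f =1 f' -> g =1 g' -> minor A f g = minor A f' g'.
Proof.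
by move=> ff gg; rewrite /minor; congr (\det _); apply/matrixP => i j;
   rewrite !mxE ff gg.
Qed.

Lemma minor_tr (R : realFieldType) (n k : nat) (A : 'M[R]_n)
    (f g : 'I_k -> 'I_n) : minor A^T f g = minor A g f.
Proof. by rewrite /minor -trmx_mxsub det_tr. Qed.

Lemma minor_comp_perml (R : realFieldType) (n k : nat) (A : 'M[R]_n)
    (f g : 'I_k -> 'I_n) (s : 'S_k) :
  minor A (f \o s) g = (-1) ^+ s * minor A f g.
Proof.
have E (h : 'I_k -> 'I_n) : mxsub h g A = rowsub h (colsub g A).
  by apply/matrixP => i j; rewrite !mxE.
by rewrite /minor (E f) (E (f \o s)) det_rowsub_perm.
Qed.

Lemma minor_comp_permr (R : realFieldType) (n k : nat) (A : 'M[R]_n)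
    (f g : 'I_k -> 'I_n) (s : 'S_k) :
  minor A f (g \o s) = (-1) ^+ s * minor A f g.
Proof. by rewrite -minor_tr minor_comp_perml minor_tr. Qed.

Lemma minor_not_injr (R : realFieldType) (n k : nat) (A : 'M[R]_n)
    (f g : 'I_k -> 'I_n) : ~~ injectiveb g -> minor A f g = 0.
Proof.
by move/(det_colsub_not_inj (rowsub f A)); rewrite -mxsub_comp.
Qed.

Lemma minor_mul (R : realFieldType) (n k : nat) (A B : 'M[R]_n)
    (f g : 'I_k -> 'I_n) :
  k`!%:R * minor (A *m B) f g =
  \sum_(h : {ffun 'I_k -> 'I_n}) minor A f h * minor B h g.
Proof.
rewrite /minor.
have -> : mxsub f g (A *m B) = rowsub f A *m colsub g B.
  by apply/matrixP => i j; rewrite !mxE; apply: eq_bigr => l _; rewrite !mxE.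
by rewrite Cauchy_Binet; apply: eq_bigr => h _; rewrite -!mxsub_comp.
Qed.

(** An injective [h] is an increasing map composed with a permutation, whose sign occurs in both
    factors and cancels. *)
Lemma minor_mul_term_ge0 (R : realFieldType) (n k : nat) (e1 e2 : R)
    (A B : 'M[R]_n) (f g h : 'I_k -> 'I_n) :
  (forall h, increasing h -> 0 <= e1 * minor A f h) ->
  (forall h, increasing h -> 0 <= e2 * minor B h g) ->
  0 <= e1 * e2 * (minor A f h * minor B h g).
Proof.
move=> A0 B0; case: (boolP (injectiveb h)) => [/injectiveP hI|nI]; last first.
  by rewrite (minor_not_injr A f nI) mul0r mulr0.
have [h' [s [h'i hs]]] := increasing_perm hI.
rewrite (eq_minor A (frefl f) hs) (eq_minor B hs (frefl g)).
rewrite minor_comp_permr minor_comp_perml [X in _ * X]mulrACA -expr2.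
rewrite sqrr_sign mul1r.
by rewrite mulrACA mulr_ge0 ?A0 ?B0.
Qed.

Lemma minor_mul_ge0 (R : realFieldType) (n k : nat) (e1 e2 : R)
    (A B : 'M[R]_n) (f g : 'I_k -> 'I_n) :
  (forall h, increasing h -> 0 <= e1 * minor A f h) ->
  (forall h, increasing h -> 0 <= e2 * minor B h g) ->
  0 <= e1 * e2 * minor (A *m B) f g.
Proof.
move=> A0 B0; have k0 : 0 < k`!%:R :> R by rewrite ltr0n fact_gt0.
rewrite -(pmulr_rge0 _ k0) mulrCA minor_mul mulr_sumr.
by apply: sumr_ge0 => h _; apply: minor_mul_term_ge0.
Qed.

(** No Cauchy-Binet term has the wrong sign, so one nonzero term, through [h], is enough. *)
Lemma minor_mul_gt0 (R : realFieldType) (n k : nat) (e1 e2 : R)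
    (A B : 'M[R]_n) (f g h : 'I_k -> 'I_n) :
  (forall h, increasing h -> 0 <= e1 * minor A f h) ->
  (forall h, increasing h -> 0 <= e2 * minor B h g) ->
  0 < e1 * minor A f h -> 0 < e2 * minor B h g ->
  0 < e1 * e2 * minor (A *m B) f g.
Proof.
move=> A0 B0 Ah Bh; have k0 : 0 < k`!%:R :> R by rewrite ltr0n fact_gt0.
rewrite -(pmulr_rgt0 _ k0) mulrCA minor_mul mulr_sumr.
rewrite (bigD1 (finfun h)) //= ltr_pwDl //; last first.
  by apply: sumr_ge0 => h' _; apply: minor_mul_term_ge0.
have hh : finfun h =1 h by move=> i; rewrite ffunE.
rewrite (eq_minor A (frefl f) hh) (eq_minor B hh (frefl g)).
by rewrite mulrACA mulr_gt0.
Qed.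

(** The factor [e] is the expected sign of the minors of order [k]: 1 for totally nonnegative
    matrices, [rev_sign R k] after reversal of the columns. *)
Definition minors_ge0 (R : realFieldType) (n k : nat) (e : R) (A : 'M[R]_n) :=
  forall f g : 'I_k -> 'I_n, increasing f -> increasing g ->
  0 <= e * minor A f g.

Lemma minors_ge0_mul (R : realFieldType) (n k : nat) (e1 e2 : R)
    (A B : 'M[R]_n) :
  minors_ge0 k e1 A -> minors_ge0 k e2 B -> minors_ge0 k (e1 * e2) (A *m B).
Proof.
by move=> A0 B0 f g fi gi; apply: minor_mul_ge0 => h hi; [apply: A0|apply: B0].
Qed.

Lemma increasing_ge (k n : nat) (f : 'I_k -> 'I_n) (i : 'I_k) :
  increasing f -> (i <= f i)%N.
Proof.
move=> fi; move im : (nat_of_ord i) => m.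
elim: m i im => // m IH i im.
have mk : (m < k)%N by apply: ltnW; rewrite -im.
apply: leq_ltn_trans (IH (Ordinal mk) erefl) (fi _ _ _).
by rewrite /= im.
Qed.

(** Both [s] and its inverse are increasing, and an increasing self-map of ['I_k] dominates the
    identity. *)
Lemma perm_mono_id (k : nat) (s : 'S_k) :
  (forall i j : 'I_k, (i < j)%N -> (s i <= s j)%N) -> s = 1%g.
Proof.
move=> sm.
have si : increasing s.
  by move=> i j ij; rewrite ltn_neqAle sm // andbT (inj_eq val_inj)
     (inj_eq perm_inj) -val_eqE ltn_eqF.
have s'i : increasing (s^-1)%g.
  by move=> i j; rewrite -{1}(permKV s i) -{1}(permKV s j) !ltnNge
     (increasing_leq _ _ si).
apply/permP => i; rewrite perm1; apply/val_inj/eqP.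
rewrite eqn_leq (increasing_ge i si) andbT.
by have := increasing_ge (s i) s'i; rewrite permK.
Qed.

(* A nonzero term of the Leibniz expansion forces its permutation to be
   monotone. *)
Lemma minor_upper_bidiagonal (R : realFieldType) (n k : nat) (U : 'M[R]_n)
    (f g : 'I_k -> 'I_n) :
  (forall i j : 'I_n, ~~ (i <= j <= i.+1)%N -> U i j = 0) ->
  increasing f -> increasing g -> minor U f g = \prod_i U (f i) (g i).
Proof.
move=> U0 fi gi; rewrite /minor /determinant (bigD1 1%g) //=.
rewrite odd_perm1 expr0 mul1r [X in _ + X]big1 ?addr0 => [|s s1].
  by apply: eq_bigr => i _; rewrite mxE perm1.
apply/eqP; rewrite mulf_eq0 signr_eq0 /=; apply: contraNT s1 => nz.
have {nz} nz i : (f i <= g (s i) <= (f i).+1)%N.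
  apply: contraNT nz => /U0 Ufi; apply/prodf_eq0; exists i => //.
  by rewrite mxE Ufi.
apply/eqP/perm_mono_id => i j ij; rewrite -(increasing_leq _ _ gi).
have /andP[_ gsi] := nz i; have /andP[gsj _] := nz j.
exact: leq_trans gsi (leq_trans (fi _ _ ij) gsj).
Qed.

(** * Positivity of the minors of powers *)

Definition upper_bidiagonal_gt0 (R : realFieldType) (n : nat) (U : 'M[R]_n) :=
  forall i j : 'I_n, if (i <= j <= i.+1)%N then 0 < U i j else U i j == 0.

Lemma minor_upper_bidiagonal_ge0 (R : realFieldType) (n k : nat)
    (U : 'M[R]_n) : upper_bidiagonal_gt0 U -> minors_ge0 k 1 U.
Proof.
move=> HU f g fi gi; rewrite mul1r minor_upper_bidiagonal //.
  by apply: prodr_ge0 => i _; have := HU (f i) (g i);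
     case: ifP => _ => [/ltW|/eqP ->].
by move=> i j /negbTE ij; have := HU i j; rewrite ij => /eqP.
Qed.

Lemma minor_upper_bidiagonal_gt0 (R : realFieldType) (n k : nat)
    (U : 'M[R]_n) (f g : 'I_k -> 'I_n) : upper_bidiagonal_gt0 U ->
  increasing f -> increasing g -> (forall i, f i <= g i <= (f i).+1)%N ->
  0 < minor U f g.
Proof.
move=> HU fi gi fg; rewrite minor_upper_bidiagonal //.
  by apply: prodr_gt0 => i _; have := HU (f i) (g i); rewrite fg.
by move=> i j /negbTE ij; have := HU i j; rewrite ij => /eqP.
Qed.

Lemma minors_ge0_tr (R : realFieldType) (n k : nat) (e : R) (A : 'M[R]_n) :
  minors_ge0 k e A -> minors_ge0 k e A^T.
Proof. by move=> A0 f g fi gi; rewrite minor_tr A0. Qed.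

Section BidiagonalProduct.
Variables (R : realFieldType) (n : nat) (L U : 'M[R]_n).
Hypothesis HL : upper_bidiagonal_gt0 L^T.
Hypothesis HU : upper_bidiagonal_gt0 U.

Lemma minors_ge0_LU (k : nat) : minors_ge0 k 1 (L *m U).
Proof.
rewrite -[1]mulr1; apply: minors_ge0_mul.
  by rewrite -[L]trmxK; apply/minors_ge0_tr/minor_upper_bidiagonal_ge0.
exact: minor_upper_bidiagonal_ge0.
Qed.

(** The term through [f] itself is a principal minor of [L] times a minor of [U] whose indices move
    by at most one. *)
Lemma minor_LU_gt0_up (k : nat) (f g : 'I_k -> 'I_n) :
  increasing f -> increasing g -> (forall i, f i <= g i <= (f i).+1)%N ->
  0 < minor (L *m U) f g.
Proof.
move=> fi gi fg; rewrite -[minor _ _ _]mul1r -{1}[1]mulr1.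
apply: (@minor_mul_gt0 _ _ _ _ _ _ _ _ _ f).
- move=> h hi; rewrite -[L]trmxK.
  by apply/minors_ge0_tr => //; apply: minor_upper_bidiagonal_ge0.
- by move=> h hi; apply: minor_upper_bidiagonal_ge0.
- rewrite mul1r -minor_tr; apply: minor_upper_bidiagonal_gt0 => // i.
  by rewrite leqnn leqnSn.
- by rewrite mul1r; apply: minor_upper_bidiagonal_gt0.
Qed.

End BidiagonalProduct.

Lemma minor_LU_gt0_down (R : realFieldType) (n : nat) (L U : 'M[R]_n)
    (k : nat) (f g : 'I_k -> 'I_n) :
  upper_bidiagonal_gt0 L^T -> upper_bidiagonal_gt0 U ->
  increasing f -> increasing g -> (forall i, g i <= f i <= (g i).+1)%N ->
  0 < minor (L *m U) f g.
Proof.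
move=> HL HU fi gi fg; rewrite -minor_tr trmx_mul minor_LU_gt0_up //.
by rewrite trmxK.
Qed.

(** * Reversal of the columns and its sign *)

Definition rev_perm (k : nat) : 'S_k := perm (@rev_ord_inj k).

(** Sending the first of [k.+1] indices to the last place contributes [k] inversions, as in Pascal's
    rule for ['C(k.+1, 2)]. *)
Lemma odd_rev_perm (k : nat) : odd_perm (rev_perm k) = odd 'C(k, 2).
Proof.
elim: k => [|k IH].
  by rewrite (_ : rev_perm 0 = 1%g) ?odd_perm1 //; apply/permP; case.
have -> : rev_perm k.+1 = lift_perm ord0 ord_max (rev_perm k).
  apply/permP => i; case: (unliftP ord0 i) => [j|] ->.
    rewrite lift_perm_lift !permE; apply: val_inj => /=.
    rewrite /bump /= add1n subSS; have := ltn_ord j; lia.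
  by rewrite lift_perm_id permE; apply: val_inj; rewrite /= subSS subn0.
by rewrite odd_lift_perm IH binS bin1 oddD addbC.
Qed.

Definition rev_sign (R : realFieldType) (k : nat) : R :=
  (-1) ^+ (k * (k - 1) %/ 2).

Lemma rev_signE (R : realFieldType) (k : nat) :
  (-1) ^+ rev_perm k = rev_sign R k.
Proof. by rewrite /rev_sign odd_rev_perm signr_odd bin2 -divn2 subn1. Qed.

Lemma rev_sign_mul (R : realFieldType) (k : nat) :
  rev_sign R k * rev_sign R k = 1.
Proof. by rewrite -expr2 sqrr_sign. Qed.

(** The outer reversal acts on the columns of the matrix; the inner one restores the increasing
    order of the selection. *)
Definition flip (k n : nat) (g : 'I_k -> 'I_n) : 'I_k -> 'I_n :=
  fun i => rev_ord (g (rev_ord i)).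

Lemma flipK (k n : nat) (g : 'I_k -> 'I_n) : flip (flip g) =1 g.
Proof. by move=> i; rewrite /flip !rev_ordK. Qed.

Lemma flip_increasing (k n : nat) (g : 'I_k -> 'I_n) :
  increasing g -> increasing (flip g).
Proof.
move=> gi i j ij; have := gi (rev_ord j) (rev_ord i).
rewrite /flip /= => H; have {}H := H ltac:(move: (ltn_ord j); lia).
move: H (ltn_ord (g (rev_ord i))); lia.
Qed.

Lemma minor_colsub_rev (R : realFieldType) (n k : nat) (X : 'M[R]_n)
    (f g : 'I_k -> 'I_n) :
  minor (colsub (@rev_ord n) X) f g = rev_sign R k * minor X f (flip g).
Proof.
rewrite -rev_signE -minor_comp_permr /minor -mxsub_comp.
by congr (\det _); apply/matrixP => i j; rewrite !mxE /flip /= permE rev_ordK.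
Qed.

Section SignRegularPowers.
Variables (R : realFieldType) (n : nat) (L U : 'M[R]_n).
Hypothesis HL : upper_bidiagonal_gt0 L^T.
Hypothesis HU : upper_bidiagonal_gt0 U.
Let A : 'M[R]_n := colsub (@rev_ord n) (L *m U).

Lemma minors_ge0_revLU (k : nat) : minors_ge0 k (rev_sign R k) A.
Proof.
move=> f g fi gi; rewrite minor_colsub_rev mulrA rev_sign_mul.
exact/(minors_ge0_LU HL HU fi)/flip_increasing.
Qed.

Lemma minors_ge0_exp (k m : nat) (e : R) (X : 'M[R]_n) :
  minors_ge0 k e X -> minors_ge0 k (e ^+ m) (X ^+ m).
Proof.
move=> X0; elim: m => [|m IH]; last by rewrite !exprS; apply: minors_ge0_mul.
move=> f g fi gi; rewrite mul1r minor_upper_bidiagonal //.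
  by apply: prodr_ge0 => i _; rewrite mxE; case: eqP.
by move=> i j ij; rewrite mxE; case: eqP ij => // ->; rewrite leqnn leqnSn.
Qed.

(** In the term through [flip g] the two reversal signs cancel; what remains is the minor of
    [L *m U] at [f], [g] times a principal minor. *)
Lemma minor_sqr_gt0 (k : nat) (f g : 'I_k -> 'I_n) :
  increasing f -> increasing g ->
  0 < minor (L *m U) f g -> 0 < minor (A *m A) f g.
Proof.
move=> fi gi fg; rewrite -[minor _ _ _]mul1r -(rev_sign_mul R k).
apply: (@minor_mul_gt0 _ _ _ _ _ _ _ _ _ (flip g)).
- by move=> h hi; apply: minors_ge0_revLU.
- by move=> h hi; apply: minors_ge0_revLU.
- rewrite minor_colsub_rev mulrA rev_sign_mul mul1r.
  by rewrite (eq_minor _ (frefl f) (flipK g)).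
- rewrite minor_colsub_rev mulrA rev_sign_mul mul1r.
  have gi' := flip_increasing gi.
  by apply: minor_LU_gt0_up => // i; rewrite leqnn leqnSn.
Qed.

Lemma minors_ge0_sqr_exp (k m : nat) : minors_ge0 k 1 ((A *m A) ^+ m).
Proof.
rewrite -(expr1n R m); apply: minors_ge0_exp.
by rewrite -(rev_sign_mul R k); apply: minors_ge0_mul; apply: minors_ge0_revLU.
Qed.

Lemma minor_mulT_gt0 (k : nat) (X Y : 'M[R]_n) (f g h : 'I_k -> 'I_n) :
  increasing f -> increasing g -> minors_ge0 k 1 X -> minors_ge0 k 1 Y ->
  0 < minor X f h -> 0 < minor Y h g -> 0 < minor (X *m Y) f g.
Proof.
move=> fi gi X0 Y0 Xh Yh; rewrite -[minor _ _ _]mul1r -[X in X * _]mulr1.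
apply: (@minor_mul_gt0 _ _ _ _ _ _ _ _ _ h); rewrite ?mul1r // => l li.
  exact: X0.
exact: Y0.
Qed.

Lemma minor_exp_gt0_up (k m : nat) (f g : 'I_k -> 'I_n) :
  increasing f -> increasing g -> (forall i, f i <= g i <= f i + m)%N ->
  0 < minor ((A *m A) ^+ m) f g /\ 0 < minor ((A *m A) ^+ m) g f.
Proof.
elim: m f => [|m IH] f fi gi fg.
  have gf : g =1 f.
    by move=> i; have := fg i; rewrite addn0 -eqn_leq => /eqP/val_inj.
  rewrite (eq_minor _ gf (frefl f)) (eq_minor _ (frefl f) gf) expr0.
  suff : 0 < minor (1 : 'M[R]_n) f f by split.
  rewrite /minor (_ : mxsub f f 1 = 1%:M) ?det1 //.
  by apply/matrixP => i j; rewrite !mxE (inj_eq (increasing_inj fi)).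
(* One unit step: each index advances by one unless it has reached its target. The minimum of two
   increasing maps is increasing, and [m] further steps lead from [h] to [g]. *)
pose h i := Ordinal (leq_ltn_trans (geq_minr (f i).+1 (g i)) (ltn_ord (g i))).
have hi : increasing h.
  by move=> i j ij /=; move: (fi _ _ ij) (gi _ _ ij); lia.
have [|h1 h2] := IH h hi gi.
  by move=> i /=; move: (fg i); lia.
have [fh hf] : 0 < minor (A *m A) f h /\ 0 < minor (A *m A) h f.
  split; apply: minor_sqr_gt0 => //.
    by apply: minor_LU_gt0_up => // i /=; move: (fg i); lia.
  by apply: minor_LU_gt0_down => // i /=; move: (fg i); lia.
have B0 := @minors_ge0_sqr_exp k 1; have Bm := @minors_ge0_sqr_exp k m.
rewrite expr1 in B0; split.
  by rewrite exprS; apply: (minor_mulT_gt0 (h := h)).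
by rewrite exprSr; apply: (minor_mulT_gt0 (h := h)).
Qed.

(* Any two increasing maps are joined by a path of unit steps through their
   pointwise maximum. *)
Lemma minor_exp_gt0 (k : nat) (f g : 'I_k -> 'I_n) :
  increasing f -> increasing g -> 0 < minor (A ^+ (4 * n)) f g.
Proof.
move=> fi gi.
(* Two legs of [n] squares each, one up to the maximum and one down to [g]; every index moves by
   less than [n]. *)
have -> : A ^+ (4 * n) = (A *m A) ^+ n *m (A *m A) ^+ n.
  by rewrite -[_ *m _ in RHS]exprD -[A *m A]expr2 -exprM; congr (_ ^+ _); lia.
have hP i : (maxn (f i) (g i) < n)%N by rewrite gtn_max !ltn_ord.
pose h i := Ordinal (hP i).
have hi : increasing h.
  by move=> i j ij /=; move: (fi _ _ ij) (gi _ _ ij); lia.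
apply: (minor_mulT_gt0 (h := h)) => //; try exact: minors_ge0_sqr_exp.
  by apply: (minor_exp_gt0_up fi hi _).1 => i /=; move: (ltn_ord (g i)); lia.
by apply: (minor_exp_gt0_up gi hi _).2 => i /=; move: (ltn_ord (f i)); lia.
Qed.

End SignRegularPowers.

(** * Tridiagonal matrices *)

Definition tridiagonal (R : realFieldType) (n : nat) (a b c : nat -> R) :
    'M[R]_n :=
  \matrix_(i < n, j < n)
    if (i == j :> nat)%N then a i.+1
    else if (j == i.+1 :> nat)%N then b i.+1
    else if (i == j.+1 :> nat)%N then c i
    else 0.

Lemma anti_tridiagonalE (R : realFieldType) (n : nat) (a b c : nat -> R) :
  anti_tridiagonal n a b c = colsub (@rev_ord n) (tridiagonal n a b c).
Proof.
apply/matrixP => i j; rewrite !mxE /=; have := ltn_ord i; have := ltn_ord j.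
move=> jn i_n; do !case: eqP => //; lia.
Qed.

Lemma det_anti_tridiagonal (R : realFieldType) (n : nat) (a b c : nat -> R) :
  \det (anti_tridiagonal n a b c) = rev_sign R n * \det (tridiagonal n a b c).
Proof.
rewrite -rev_signE -[tridiagonal n a b c in RHS]mxsub_id -det_colsub_perm.
rewrite anti_tridiagonalE; congr (\det _).
by apply/matrixP => i j; rewrite !mxE /= permE.
Qed.

Lemma det_tridiagonal0 (R : realFieldType) (a b c : nat -> R) :
  \det (tridiagonal 0 a b c) = 1.
Proof. exact: det_mx00. Qed.

Lemma det_tridiagonal1 (R : realFieldType) (a b c : nat -> R) :
  \det (tridiagonal 1 a b c) = a 1%N.
Proof. by rewrite det_mx11 mxE. Qed.

(** Expansion along the last row; the minor that multiplies [c k.+1] is then expanded along its last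
    column. *)
Lemma det_tridiagonalSS (R : realFieldType) (k : nat) (a b c : nat -> R) :
  \det (tridiagonal k.+2 a b c) =
  a k.+2 * \det (tridiagonal k.+1 a b c) -
  b k.+1 * c k.+1 * \det (tridiagonal k a b c).
Proof.
rewrite (expand_det_row _ ord_max) big_ord_recr big_ord_recr /=.
rewrite big1 ?add0r => [|i _]; last first.
  rewrite mxE /=; have := ltn_ord i; do !case: eqP => //=; try lia.
  by rewrite mul0r.
rewrite addrC; congr (_ + _).
  rewrite mxE eqxx /cofactor /= addnn -signr_odd odd_double mul1r.
  congr (_ * \det _).
  by apply/matrixP => i j; rewrite !mxE !lift_max.
rewrite mxE /= eqn_leq ltnn eqn_leq ltnNge leqnSn /= eqxx.
rewrite /cofactor /= addSn addnn -signr_odd /= odd_double expr1 mulN1r mulrN.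
congr (- _); rewrite [b _ * _]mulrC -mulrA; congr (_ * _).
  by rewrite andbF.
rewrite (expand_det_col _ ord_max) big_ord_recr /=.
rewrite big1 ?add0r => [|i _]; last first.
  rewrite !mxE /= /bump; have := ltn_ord i.
  by do !case: eqP => //=; rewrite ?mul0r //; lia.
congr (_ * _).
  rewrite !mxE /= /bump ltnn leqnn add0n add1n eqxx.
  by rewrite (ltn_eqF (leqnn _)).
rewrite /cofactor addnn -signr_odd odd_double mul1r; congr (\det _).
apply/matrixP => i j; rewrite !mxE !lift_max.
have jk : (k <= j)%N = false by rewrite leqNgt (ltn_ord j).
by rewrite /= /bump jk !add0n jk !add0n.
Qed.

Lemma tridiagonal_LU (R : realFieldType) (n : nat) (a b c : nat -> R) :
  (forall j, (1 <= j <= n - 1)%N -> 0 < b j /\ 0 < c j) ->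
  (forall k, (k <= n)%N -> 0 < \det (tridiagonal k a b c)) ->
  exists L U : 'M[R]_n, [/\ upper_bidiagonal_gt0 L^T, upper_bidiagonal_gt0 U
    & tridiagonal n a b c = L *m U].
Proof.
move=> bc0 D0.
(* The pivots of Gaussian elimination. On the diagonal, the identity to check is the three-term
   recurrence divided by a leading minor. *)
pose d i := \det (tridiagonal i.+1 a b c) / \det (tridiagonal i a b c).
have d0 i : (i < n)%N -> 0 < d i by move=> i_n; rewrite divr_gt0 ?D0 // ltnW.
pose L : 'M[R]_n := \matrix_(i, j) if (i == j :> nat)%N then d i
  else if (i == j.+1 :> nat)%N then c i else 0.
pose U : 'M[R]_n := \matrix_(i, j) if (i == j :> nat)%N then 1
  else if (j == i.+1 :> nat)%N then b j / d i else 0.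
exists L, U; split.
- move=> i j; rewrite !mxE; case: ifP => ij.
    case: eqP => [->|ne]; first exact: d0.
    case: eqP => [e|]; last by lia.
    by apply: (bc0 _ _).2; have := ltn_ord j; lia.
  by do !case: eqP => //; lia.
- move=> i j; rewrite !mxE; case: ifP => ij.
    case: eqP => [//|ne]; case: eqP => [e|]; last by lia.
    rewrite divr_gt0 ?d0 //; apply: (bc0 _ _).1; have := ltn_ord j; lia.
  by do !case: eqP => //; lia.
apply/matrixP => i j; rewrite !mxE.
have LU0 (l : 'I_n) : l != i -> l.+1 != i -> L i l * U l j = 0.
  rewrite -val_eqE /= => li lSi.
  rewrite [L i l]mxE [i == l :> nat]eq_sym (negbTE li).
  by rewrite [i == l.+1 :> nat]eq_sym (negbTE lSi) mul0r.
rewrite (bigD1 i) //= [L i i]mxE eqxx [U i j]mxE.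
case: (posnP i) => [i0|i0].
  rewrite big1 ?addr0 => [|l li]; last by rewrite LU0 // i0.
  rewrite i0; case: eqP => [j0|j0].
    by rewrite mulr1 /d det_tridiagonal1 det_tridiagonal0 divr1.
  case: eqP => [->|_]; last by rewrite mulr0.
  by rewrite mulrC divfK ?gt_eqF ?d0 // -?i0.
have pi : (i.-1 < n)%N by rewrite (leq_ltn_trans (leq_pred _)).
rewrite (bigD1 (Ordinal pi)) /=; last by rewrite -val_eqE /= neq_ltn ltn_predL i0.
rewrite big1 ?addr0 => [|l /andP[li lpi]]; last first.
  by rewrite LU0 //; move: lpi; rewrite -val_eqE /=; apply: contra; lia.
rewrite !mxE /= prednK // eqxx.
have -> : (i == i.-1 :> nat)%N = false by lia.
have di : d i != 0 by rewrite gt_eqF ?d0.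
have dp : d i.-1 != 0 by rewrite gt_eqF ?d0.
case: eqP => [<-|ij].
  have -> : (i.-1 == i :> nat)%N = false by lia.
  rewrite eqxx mulr1 /d prednK //; move: i0 pi di dp.
  case: (nat_of_ord i) (ltn_ord i) => //= m mn _ mn' _ _.
  rewrite det_tridiagonalSS.
  have D1 : \det (tridiagonal m.+1 a b c) != 0 by rewrite gt_eqF ?D0 // ltnW.
  have D2 : \det (tridiagonal m a b c) != 0 by rewrite gt_eqF ?D0 // ltnW.
  by field; apply/andP.
case: eqP => [ji|ji].
  have -> : (i.-1 == j :> nat)%N = false by lia.
  have -> : (j == i :> nat)%N = false by lia.
  by rewrite mulr0 addr0 mulrC ji divfK.
rewrite mulr0 add0r; case: eqP => [ij'|ij'].
  have -> : (i.-1 == j :> nat)%N by lia.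
  by rewrite mulr1.
have -> : (i.-1 == j :> nat)%N = false by lia.
have -> : (j == i :> nat)%N = false by lia.
by rewrite mulr0.
Qed.

(** * Sign definiteness, and necessity of the determinant conditions *)

Lemma rev_sign_neq0 (R : realFieldType) (k : nat) : rev_sign R k != 0.
Proof. by rewrite signr_eq0. Qed.

Lemma sg_rev_sign (R : realFieldType) (k : nat) :
  Num.sg (rev_sign R k) = rev_sign R k.
Proof. by rewrite sgrX sgrN1. Qed.

Lemma sg_rev_sign_mul (R : realFieldType) (k : nat) (x : R) : 0 < x ->
  Num.sg (rev_sign R k * x) = rev_sign R k.
Proof. by move=> x0; rewrite sgrM (gtr0_sg x0) mulr1 sg_rev_sign. Qed.

Lemma sign_definite_of_minors_ge0 (R : realFieldType) (n : nat)
    (A : 'M[R]_n) : (forall k, minors_ge0 k (rev_sign R k) A) ->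
  sign_definite A.
Proof.
move=> A0 k _; exists (rev_sign R k); split.
  by rewrite /rev_sign -signr_odd; case: odd; [right|left].
move=> f g fi gi nz.
have -> : minor A f g = rev_sign R k * (rev_sign R k * minor A f g).
  by rewrite mulrA rev_sign_mul mul1r.
by rewrite sg_rev_sign_mul // lt_neqAle eq_sym mulf_neq0 ?rev_sign_neq0 ?A0.
Qed.

Lemma strictly_sign_definite_of_minors_gt0 (R : realFieldType) (n : nat)
    (A : 'M[R]_n) :
  (forall k (f g : 'I_k -> 'I_n), increasing f -> increasing g ->
     0 < minor A f g) -> strictly_sign_definite A.
Proof.
move=> A0; split=> k _; last first.
  by move=> f g fi gi; rewrite gt_eqF ?A0.
by exists 1; split=> [|f g fi gi _]; [left|rewrite gtr0_sg ?A0].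
Qed.

Lemma self_interlacing_det (R : realFieldType) (n : nat) (A : 'M[R]_n) :
  self_interlacing_spectrum A -> 0 < rev_sign R n * \det A.
Proof.
case=> lam [chi _ _ lam0].
(* The exponents 0, 1, ..., n - 1 of the signs add up to n(n - 1)/2, and the determinant is the
   product of the eigenvalues. *)
have -> : rev_sign R n * \det A = \prod_(i < n) ((-1) ^+ i * lam i).
  rewrite big_split /= prodrXr; congr (_ * _).
    rewrite /rev_sign subn1 divn2 -bin2 -bin2_sum; congr (_ ^+ _).
    by rewrite big_mkord.
  have := char_poly_det A; rewrite chi -horner_coef0 horner_prod.
  under eq_bigr => i _ do rewrite hornerXsubC sub0r.
  rewrite prodrN card_ord => /mulrI -> //.
  exact: unitrX (unitrN1 _).
by apply: prodr_gt0 => i _; apply: lam0.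
Qed.

Section Converse.
Variables (R : realFieldType) (n : nat) (a b c : nat -> R).
Hypothesis abc0 : forall j : nat, (1 <= j <= n - 1)%N ->
  [/\ 0 < a j, 0 < b j & 0 < c j].
Hypothesis sdA : sign_definite (anti_tridiagonal n a b c).
Let T := tridiagonal n a b c.
Local Notation D k := (\det (tridiagonal k a b c)).

(* The minor b_1 ... b_k of rows 0..k-1 and columns 1..k fixes the sign. *)
Lemma minor_tridiagonal_ge0 (k : nat) : (1 <= k < n)%N ->
  forall f g : 'I_k -> 'I_n, increasing f -> increasing g -> 0 <= minor T f g.
Proof.
move=> /andP[k1 kn]; have /sdA[eps [_ epsP]] : (1 <= k <= n)%N.
  by rewrite k1 ltnW.
have E (f g : 'I_k -> 'I_n) : minor (anti_tridiagonal n a b c) f (flip g) =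
    rev_sign R k * minor T f g.
  by rewrite anti_tridiagonalE minor_colsub_rev (eq_minor _ (frefl f) (flipK g)).
have epsE : eps = rev_sign R k.
  pose f i : 'I_n := widen_ord (ltnW kn) i.
  pose g (i : 'I_k) : 'I_n := Ordinal (leq_ltn_trans (ltn_ord i) kn).
  have T0 : 0 < minor T f g.
    rewrite /minor det_trig.
      apply: prodr_gt0 => i _; rewrite !mxE /= (ltn_eqF (leqnn _)) eqxx.
      by have [] // := abc0 (j := i.+1) _; have := ltn_ord i; lia.
    apply/is_trig_mxP => i j ij; rewrite !mxE /=.
    by do !case: eqP => //; lia.
  rewrite -(epsP f (flip g)) ?E ?sg_rev_sign_mul //.
  - by move=> i j ij; apply: flip_increasing.
  - by rewrite mulf_neq0 ?rev_sign_neq0 ?gt_eqF.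
move=> f g fi gi; have [->//|nz] := eqVneq (minor T f g) 0.
have := epsP f (flip g) fi (flip_increasing gi).
rewrite E epsE mulf_neq0 ?rev_sign_neq0 // => /(_ isT).
rewrite sgrM sg_rev_sign -[X in _ = X]mulr1.
by move=> /(mulfI (rev_sign_neq0 _ _))/eqP; rewrite sgr_cp0 => /ltW.
Qed.

Lemma det_tridiagonal_gt0 : (0 < n)%N -> 0 < D n ->
  forall k, (k <= n)%N -> 0 < D k.
Proof.
move=> n0 Dn; have Dn' m : m = n -> 0 < D m by move->.
have D_ge0 k : (k <= n)%N -> 0 <= D k.
  case: (posnP k) => [->|k0]; first by rewrite det_tridiagonal0.
  rewrite leq_eqVlt => /predU1P[kn|kn]; first exact/ltW/Dn'.
  have kn' : (1 <= k < n)%N by rewrite k0.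
  pose f i := widen_ord (ltnW kn) i.
  have := @minor_tridiagonal_ge0 k kn' f f; rewrite /minor.
  have -> : mxsub f f T = tridiagonal k a b c.
    by apply/matrixP => i j; rewrite !mxE.
  by apply=> i j.
suff H k : (k < n)%N -> 0 < D k /\ 0 < D k.+1.
  by case=> [|k] kn; [rewrite det_tridiagonal0|case: (H k kn)].
elim: k => [|k IH] kn.
  (* For [n = 1] the sign of [a 1] is given by [D n]; for larger [n] it is among the hypotheses. *)
  rewrite det_tridiagonal0; split=> //; move: n0; rewrite leq_eqVlt.
  case/predU1P => [n1|n2]; first exact: Dn'.
  by rewrite det_tridiagonal1; case: (@abc0 1) => //; lia.
have [D0 D1] := IH (ltnW kn); split=> //.
move: kn; rewrite leq_eqVlt => /predU1P[kn|kn]; first exact: Dn'.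
(* If [D k.+2] vanished, the recurrence would give [D k.+3] the sign of [- D k.+1], hence make it
   negative. *)
rewrite lt_neqAle D_ge0 1?ltnW // andbT eq_sym; apply/eqP => D2.
have := D_ge0 _ kn; rewrite det_tridiagonalSS D2 mulr0 sub0r oppr_ge0.
by have [_ b0 c0] := @abc0 k.+2 ltac:(lia); rewrite leNgt !mulr_gt0.
Qed.

End Converse.

(** * Real simple spectrum of strictly totally positive matrices *)

Definition Krylov (R : realFieldType) (n : nat) (B : 'M[R]_n.+1) : 'M[R]_n.+1 :=
  \matrix_(i, j) (B ^+ j) i 0.

(* Since the first column is e_0, a minor through row 0 equals a minor of
   [B *m Krylov B] of order one less. *)
Lemma minor_Krylov_ge0 (R : realFieldType) (n : nat) (B : 'M[R]_n.+1) :
  (forall k (f g : 'I_k -> 'I_n.+1), increasing f -> increasing g ->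
     0 < minor B f g) ->
  forall k (kn : (k <= n.+1)%N) (f : 'I_k -> 'I_n.+1), increasing f ->
  0 <= minor (Krylov B) f (widen_ord kn) /\
  ((forall i, nat_of_ord i = 0%N -> f i = 0) ->
     0 < minor (Krylov B) f (widen_ord kn)).
Proof.
move=> B0; elim=> [|k IH] kn f fi.
  by rewrite /minor det_mx00.
have col0 i : (mxsub f (widen_ord kn) (Krylov B)) i 0 = (f i == 0)%:R.
  by rewrite !mxE.
case: (eqVneq (f 0) 0) => [f0|f0]; last first.
  have fN0 i : f i != 0.
    apply: contra_neq f0 => fi0; apply: val_inj; apply/eqP.
    by rewrite -leqn0 -[X in (_ <= X)%N]/(nat_of_ord (0 : 'I_n.+1)) -fi0
      increasing_leq.
  split; last by move=> /(_ 0 erefl) f00; rewrite f00 eqxx in f0.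
  rewrite /minor (expand_det_col _ 0) big1 // => i _.
  by rewrite col0 (negbTE (fN0 i)) mul0r.
pose f' i := f (lift 0 i).
have f'i : increasing f' by move=> i j ij; apply: fi; rewrite !lift0.
have -> : minor (Krylov B) f (widen_ord kn) =
    minor (B *m Krylov B) f' (widen_ord (ltnW kn)).
  rewrite /minor (expand_det_col _ 0) (bigD1 0) //= col0 f0 eqxx mul1r.
  rewrite big1 ?addr0 => [|i i0]; last first.
    have fi0 : (f i == 0) = false.
      apply/negbTE; apply: contra_neq i0 => fi0.
      by apply: (increasing_inj fi); rewrite f0.
    by rewrite col0 fi0 mul0r.
  rewrite /cofactor expr0 mul1r; congr (\det _); apply/matrixP => i j.
  rewrite !mxE /= /bump /= add1n exprS -[_ * _]/(_ *m _) mxE.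
  by apply: eq_bigr => l _; rewrite !mxE.
have w_i : increasing (widen_ord (ltnW kn)) by move=> i j.
have K0 h : increasing h -> 0 <= 1 * minor (Krylov B) h (widen_ord (ltnW kn)).
  by move=> hi; rewrite mul1r; apply: (IH _ _ hi).1.
have f'B h : increasing h -> 0 <= 1 * minor B f' h.
  by move=> hi; rewrite mul1r ltW ?B0.
suff P : 0 < minor (B *m Krylov B) f' (widen_ord (ltnW kn)).
  by split; first exact: ltW.
rewrite -[minor _ _ _]mul1r -[X in X * _]mulr1.
(* Strictness comes from the leading rows, to which the positivity half of the induction hypothesis
   applies. *)
apply: (minor_mul_gt0 (h := widen_ord (ltnW kn))) => //.
  by rewrite mul1r B0.
rewrite mul1r; apply: (IH _ _ w_i).2 => i i0; exact: val_inj.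
Qed.

Lemma trmxX (R : comNzRingType) (n : nat) (B : 'M[R]_n.+1) (m : nat) :
  (B ^+ m)^T = B^T ^+ m.
Proof.
elim: m => [|m IH]; first by rewrite !expr0 trmx1.
by rewrite exprS exprSr -IH -[_ * _ in RHS]/(_ *m _) -trmx_mul.
Qed.

(** The moment of index [i + j] is the scalar product of column [i] of [Krylov B^T] with column [j]
    of [Krylov B], so Cauchy-Binet applies to the Hankel matrix. *)
Lemma det_Hankel_gt0 (R : realFieldType) (n : nat) (B : 'M[R]_n.+1) :
  (forall k (f g : 'I_k -> 'I_n.+1), increasing f -> increasing g ->
     0 < minor B f g) ->
  forall k, (k <= n.+1)%N ->
  0 < \det (\matrix_(i < k, j < k) (B ^+ (i + j)) 0 0).
Proof.
move=> B0 k kn; pose w := widen_ord kn.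
have wi : increasing w by move=> i j.
have w0 i : nat_of_ord i = 0%N -> w i = 0 by move=> i0; apply: val_inj.
have B0' l (f g : 'I_l -> 'I_n.+1) :
    increasing f -> increasing g -> 0 < minor B^T f g.
  by move=> fi gi; rewrite minor_tr B0.
have -> : \matrix_(i < k, j < k) (B ^+ (i + j)) 0 0 =
    mxsub w w ((Krylov B^T)^T *m Krylov B).
  apply/matrixP => i j; rewrite !mxE exprD -[_ * _]/(_ *m _) mxE.
  by apply: eq_bigr => l _; rewrite !mxE -trmxX mxE.
rewrite -[\det _]/(minor _ w w) -[minor _ _ _]mul1r -[X in X * _]mulr1.
apply: (minor_mul_gt0 (h := w)) => [h hi|h hi||]; rewrite mul1r ?minor_tr.
- exact: (minor_Krylov_ge0 B0' kn hi).1.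
- exact: (minor_Krylov_ge0 B0 kn hi).1.
- exact: (minor_Krylov_ge0 B0' kn wi).2.
- exact: (minor_Krylov_ge0 B0 kn wi).2.
Qed.

(* The cofactors of the last row of the Hankel matrix are the coefficients of
   the orthogonal polynomial of degree [k]. *)
Lemma moment_functional_gt0 (R : realFieldType) (L : {scalar {poly R}})
    (n : nat) :
  (forall k, (k <= n)%N -> 0 < \det (\matrix_(i < k, j < k) L 'X^(i + j))) ->
  forall p : {poly R}, p != 0 -> (size p <= n)%N -> 0 < L (p ^+ 2).
Proof.
move=> H0; suff S k : (k <= n)%N ->
    forall p : {poly R}, p != 0 -> (size p <= k)%N -> 0 < L (p ^+ 2).
  by move=> p; apply: S.
elim: k => [_ p p0|k IH kn p p0 pk].
  by rewrite leqn0 size_poly_eq0 (negbTE p0).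
pose H m := \matrix_(i < m, j < m) L 'X^(i + j).
pose q := \poly_(j < k.+1) cofactor (H k.+1) ord_max (inord j).
have q_size : (size q <= k.+1)%N by apply: size_poly.
have qk : q`_k = \det (H k).
  rewrite coef_poly ltnSn -[k in inord k]/(nat_of_ord (@ord_max k)) inord_val.
  rewrite /cofactor addnn -signr_odd odd_double mul1r; congr (\det _).
  by apply/matrixP => i j; rewrite !mxE !lift_max.
(* The last column of [H *m \adj H = (\det H)%:M] says that [q] is orthogonal to all lower powers of
   ['X]. *)
have Lq (i : 'I_k.+1) : L (q * 'X^i) = \det (H k.+1) *+ (i == ord_max).
  have -> : \det (H k.+1) *+ (i == ord_max) =
      (H k.+1 *m \adj (H k.+1)) i ord_max.
    by rewrite mul_mx_adj mxE.
  rewrite mxE /q poly_def mulr_suml linear_sum; apply: eq_bigr => j _.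
  by rewrite -scalerAl linearZ /= inord_val -exprD !mxE addnC mulrC.
have qs0 : 0 < q`_k by rewrite qk H0 // ltnW.
have L_orth (r : {poly R}) : (size r <= k)%N -> L (q * r) = 0.
  move=> rk; rewrite -{1}[r](take_poly_id rk) /take_poly poly_def mulr_sumr.
  rewrite linear_sum big1 // => i _; rewrite -scalerAr linearZ /=.
  rewrite -[nat_of_ord i]/(nat_of_ord (widen_ord (leqnSn k) i)) Lq.
  by rewrite -val_eqE /= ltn_eqF //= mulr0n mulr0.
have Lqk : L (q * 'X^k) = \det (H k.+1).
  by rewrite -[k in 'X^k]/(nat_of_ord (@ord_max k)) Lq eqxx.
have drop (r : {poly R}) : (size r <= k.+1)%N -> r`_k = 0 -> (size r <= k)%N.
  move=> rk r0; apply/leq_sizeP => j kj; case: (eqVneq k j) => [<-//|kj'].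
  by apply: (leq_sizeP _ _ rk); rewrite ltn_neqAle kj' kj.
have Lqq : 0 < L (q ^+ 2).
  have -> : q ^+ 2 = q`_k *: (q * 'X^k) + q * (q - q`_k *: 'X^k).
    by rewrite mulrBr -scalerAr addrC subrK.
  rewrite linearD linearZ /= Lqk L_orth ?addr0 ?mulr_gt0 ?H0 //.
  apply: drop; last by rewrite coefB coefZ coefXn eqxx mulr1 subrr.
  by rewrite (leq_trans (size_polyD _ _)) // size_polyN geq_max q_size
     (leq_trans (size_scale_leq _ _)) // size_polyXn.
(* Subtracting [t *: q] removes the coefficient of degree [k]. The cross term vanishes by
   orthogonality, and induction handles [r]. *)
pose t := p`_k / q`_k; pose r := p - t *: q.
have rk : (size r <= k)%N.
  apply: drop; last by rewrite coefB coefZ divfK ?subrr ?gt_eqF.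
  by rewrite (leq_trans (size_polyD _ _)) // size_polyN geq_max pk
     (leq_trans (size_scale_leq _ _)).
have -> : p ^+ 2 = (t ^+ 2) *: q ^+ 2 + (t *+ 2) *: (q * r) + r ^+ 2.
  have -> : p = t *: q + r by rewrite addrC subrK.
  by rewrite sqrrD exprZn -scalerAl scalerMnl.
rewrite !linearD !linearZ /= L_orth // mulr0 addr0.
have [r0|r0] := eqVneq r 0.
  rewrite r0 expr0n /= linear0 addr0 mulr_gt0 // exprn_even_gt0 //=.
  apply: contra_neq p0 => t0; move: r0; rewrite /r t0 scale0r subr0; exact.
apply: ltr_wpDl; first by rewrite mulr_ge0 ?sqr_ge0 // ltW.
by apply: IH => //; apply: ltnW.
Qed.

(** One hypothesis excludes both defects: with [b] nonzero a pair of conjugate roots, with [b = 0] a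
    double real root. *)
Lemma real_rooted_poly (R : rcfType) (p : {poly R}) : p \is monic ->
  (forall (a b : R) (g : {poly R}),
     p != (('X - a%:P) ^+ 2 + (b ^+ 2)%:P) * g) ->
  exists2 r : seq R, uniq r & p = \prod_(x <- r) ('X - x%:P).
Proof.
move=> p_monic Hp; pose C := real_complex R.
have [s pC] := closed_field_poly_normal (map_poly C p).
rewrite lead_coef_map (monicP p_monic) rmorph1 scale1r in pC.
have s_real z : z \in s -> complex.Im z = 0.
  move=> zs; have : root (map_poly C p) z by rewrite pC root_prod_XsubC.
  case: z {zs} => a b; apply: contraTeq => /= b0; apply/negP => pz.
  pose m : {poly R} := ('X - a%:P) ^+ 2 + (b ^+ 2)%:P.
  have m_size : size m = 3%N.
    by rewrite /m size_polyDl ?size_exp_XsubC //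
      (leq_ltn_trans (size_polyC_leq1 _)).
  have m0 : m != 0 by rewrite -size_poly_eq0 m_size.
  have mz : (map_poly C m).[(a +i* b)%C] = 0.
    rewrite /m rmorphD rmorphXn /= map_polyXsubC map_polyC !hornerE.
    by apply/eqP; rewrite eq_complex /=; apply/andP; split; apply/eqP; ring.
  (* The remainder is a real polynomial of degree at most one with a nonreal root, hence zero. *)
  have rz : (map_poly C (p %% m)).[(a +i* b)%C] = 0.
    move: pz; rewrite /root {1}(divp_eq p m) rmorphD rmorphM /= hornerD hornerM.
    by rewrite mz mulr0 add0r => /eqP.
  have r_size : (size (p %% m)%R <= 2)%N by rewrite -ltnS -m_size ltn_modp.
  have r0 : p %% m = 0.
    move: rz; rewrite (horner_coef_wide _ (n := 2)) ?size_map_poly //.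
    rewrite !big_ord_recl big_ord0 !coef_map /= => /eqP.
    rewrite eq_complex /= => /andP[/eqP h1 /eqP h2].
    have c1 : (p %% m)`_1 = 0.
      by apply: (mulIf b0); rewrite mul0r; move: h2; rewrite /bump /=; lra.
    have c0 : (p %% m)`_0 = 0 by move: h1; rewrite /bump /= c1; lra.
    apply/polyP => -[|[|i]]; rewrite coef0 //.
    by apply: (leq_sizeP _ _ r_size).
  by have := Hp a b (p %/ m); rewrite mulrC {1}(divp_eq p m) r0 addr0 eqxx.
have pE : p = \prod_(x <- map (@complex.Re R) s) ('X - x%:P).
  apply: (map_poly_inj C); rewrite pC rmorph_prod big_map.
  rewrite big_seq [RHS]big_seq; apply: eq_bigr => z /s_real z0 /=.
  rewrite map_polyXsubC; congr ('X - _%:P).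
  by case: z z0 => x y /= ->.
exists (map (@complex.Re R) s) => //.
have dbl (r : seq R) : ~~ uniq r -> exists x g,
    \prod_(x <- r) ('X - x%:P) = ('X - x%:P) ^+ 2 * g.
  elim: r => //= x r IH; rewrite negb_and negbK => /orP[xr|/IH[y [g yg]]].
    exists x, (\prod_(y <- rem x r) ('X - y%:P)).
    by rewrite big_cons (perm_big _ (perm_to_rem xr)) big_cons expr2 mulrA.
  by exists y, (('X - x%:P) * g); rewrite big_cons yg mulrCA.
apply/negPn/negP => /dbl[x [g]]; rewrite -pE => pg.
by have := Hp x 0 g; rewrite expr0n /= addr0 {1}pg eqxx.
Qed.

(** The moment functional, named so that it can carry the linear structure that
    [moment_functional_gt0] expects. *)
Definition corner (R : comNzRingType) (n : nat) (B : 'M[R]_n.+1)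
  (p : {poly R}) : R := horner_mx B p 0 0.

Lemma corner_is_scalar (R : comNzRingType) (n : nat) (B : 'M[R]_n.+1) :
  scalar (corner B).
Proof. by move=> t p q; rewrite /corner linearP !mxE. Qed.

HB.instance Definition _ (R : comNzRingType) (n : nat) (B : 'M[R]_n.+1) :=
  GRing.isLinear.Build R {poly R} R _ (corner B) (corner_is_scalar B).

(* If [(X - a)^2 + b^2] times [g] were the characteristic polynomial, the
   moment functional would vanish on [((X - a)g)^2 + (bg)^2]. *)
Lemma minors_gt0_real_spectrum (R : rcfType) (n : nat) (B : 'M[R]_n.+1) :
  (forall k (f g : 'I_k -> 'I_n.+1), increasing f -> increasing g ->
     0 < minor B f g) ->
  exists2 r : seq R, uniq r & char_poly B = \prod_(x <- r) ('X - x%:P).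
Proof.
move=> B0; apply: real_rooted_poly; first exact: char_poly_monic.
move=> a b g; apply/eqP => chi.
have L0 (p : {poly R}) : p != 0 -> (size p <= n.+1)%N -> 0 < corner B (p ^+ 2).
  apply: moment_functional_gt0 => k kn.
  have := det_Hankel_gt0 B0 kn; congr (0 < \det _).
  apply/matrixP => i j; rewrite mxE [RHS]mxE /= /corner rmorphXn /=.
  by rewrite horner_mx_X.
have m_monic : ('X - a%:P) ^+ 2 + (b ^+ 2)%:P \is monic.
  rewrite monicE lead_coefDl ?(monicP (monic_exp _ (monicXsubC _))) //.
  by rewrite size_exp_XsubC (leq_ltn_trans (size_polyC_leq1 _)).
have m_size : size (('X - a%:P) ^+ 2 + (b ^+ 2)%:P) = 3%N.
  by rewrite size_polyDl ?size_exp_XsubC // (leq_ltn_trans (size_polyC_leq1 _)).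
have g0 : g != 0.
  by apply: contra_eq_neq chi => ->; rewrite mulr0 monic_neq0 // char_poly_monic.
have g_size : size g = n.
  by have := size_char_poly B; rewrite chi size_monicM // m_size => -[].
have Xg0 : ('X - a%:P) * g != 0 by rewrite mulf_neq0 // polyXsubC_eq0.
have : corner B (char_poly B * g) = 0.
  by rewrite /corner rmorphM /= Cayley_Hamilton mul0r mxE.
have -> : char_poly B * g = (('X - a%:P) * g) ^+ 2 + b ^+ 2 *: g ^+ 2.
  by rewrite chi -mul_polyC; ring.
apply/eqP; rewrite linearD linearZ /= gt_eqF // ltr_pwDl //.
  by rewrite L0 // size_monicM ?monicXsubC // size_XsubC g_size.
by rewrite mulr_ge0 ?sqr_ge0 // ltW // L0 // g_size.
Qed.

(** * Moduli and signs of the eigenvalues *)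

Lemma char_poly_simmx (F : fieldType) (n : nat) (P A D : 'M[F]_n) :
  P \in unitmx -> P *m A = D *m P -> char_poly A = char_poly D.
Proof.
move=> Pu PA; pose Q := map_mx (@polyC F) P.
have Q0 : \det Q != 0.
  by rewrite det_map_mx polyC_eq0 -unitfE -unitmxE.
apply: (mulfI Q0); rewrite [RHS]mulrC -!det_mulmx; congr (\det _).
rewrite mulmxBr mulmxBl -!map_mxM PA; congr (_ - _).
by rewrite scalar_mxC.
Qed.

Lemma char_poly_diag (R : comNzRingType) (n : nat) (d : 'rV[R]_n) :
  char_poly (diag_mx d) = \prod_(i < n) ('X - (d 0 i)%:P).
Proof.
rewrite char_poly_trig ?diag_mx_is_trig //.
by apply: eq_bigr => i _; rewrite mxE eqxx.
Qed.

(** In an eigenbasis of [B], the matrix [A] commutes with a diagonal matrix with distinct entries,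
    so it is diagonal too. *)
Lemma commuting_diagonalization (F : fieldType) (n : nat)
    (A B : 'M[F]_n.+1) (r : seq F) :
  uniq r -> char_poly B = \prod_(x <- r) ('X - x%:P) ->
  A *m B = B *m A ->
  exists (P : 'M[F]_n.+1) (d d' : 'rV[F]_n.+1),
    [/\ P \in unitmx, P *m A = diag_mx d *m P, P *m B = diag_mx d' *m P
      & injective (d' 0)].
Proof.
move=> ru chiB AB.
have [P Pu /diagonalizable_forPex[d' /(simmxP Pu) PB]] : diagonalizable B.
  by apply/diagonalizableP; exists r; rewrite // -chiB mxminpoly_dvd_char.
(* By counting: the [n.+1] distinct roots in [r] all occur among the [n.+1] entries of [d']. *)
have d'I : injective (d' 0).
  have chiD := char_poly_simmx Pu PB; rewrite char_poly_diag chiB in chiD.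
  have D_size : size (codom (d' 0)) = n.+1 by rewrite size_codom card_ord.
  apply/injectiveP/(leq_size_uniq ru) => [x xr|].
    have : root (\prod_(i < n.+1) ('X - (d' 0 i)%:P)) x.
      by rewrite -chiD root_prod_XsubC.
    by rewrite /root horner_prod => /prodf_eq0[i _];
       rewrite hornerXsubC subr_eq0 => /eqP ->; apply: codom_f.
  rewrite D_size; have := size_char_poly B.
  by rewrite chiB size_prod_XsubC => -[->].
pose M := P *m A *m invmx P.
have PA : P *m A = M *m P by rewrite mulmxKV.
have MD : M *m diag_mx d' = diag_mx d' *m M.
  have D_E : diag_mx d' = P *m B *m invmx P by rewrite PB mulmxK.
  by rewrite D_E /M !mulmxA !mulmxKV // -!mulmxA (mulmxA A) AB !mulmxA.
exists P, (\row_i M i i), d'; split=> //.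
rewrite PA; congr (_ *m _); apply/matrixP => i j; rewrite !mxE.
case: eqVneq => [->|ij]; first by rewrite mulr1n.
rewrite mulr0n; have /matrixP/(_ i j) := MD.
rewrite mul_mx_diag mul_diag_mx !mxE mulrC => /eqP.
rewrite -subr_eq0 -mulrBl mulf_eq0 => /orP[|/eqP //].
by rewrite subr_eq0 (inj_eq d'I) eq_sym (negbTE ij).
Qed.

Lemma diag_mxX (R : comNzRingType) (n : nat) (d : 'rV[R]_n.+1) (m : nat) :
  diag_mx d ^+ m = diag_mx (\row_i d 0 i ^+ m).
Proof.
elim: m => [|m IH].
  by apply/matrixP => i j; rewrite !mxE.
rewrite exprS IH -[_ * _]/(_ *m _) mulmx_diag.
by congr diag_mx; apply/rowP => i; rewrite !mxE exprS.
Qed.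

Lemma simmxX (R : comNzRingType) (n : nat) (P A D : 'M[R]_n.+1) (m : nat) :
  P *m A = D *m P -> P *m A ^+ m = D ^+ m *m P.
Proof.
move=> PA; elim: m => [|m IH]; first by rewrite !expr0 mulmx1 mul1mx.
by rewrite exprSr exprS -![_ * _]/(_ *m _) mulmxA IH -!mulmxA PA !mulmxA
   -[_ *m D in LHS]exprSr exprS.
Qed.

(** An even power of a real number depends only on its modulus, so distinct eigenvalues of [A ^+ N]
    come from eigenvalues of [A] with distinct moduli. *)
Lemma ordered_diagonalization (R : rcfType) (n N : nat) (A : 'M[R]_n.+1) :
  (forall k (f g : 'I_k -> 'I_n.+1), increasing f -> increasing g ->
     0 < minor (A ^+ N) f g) ->
  ~~ odd N -> (0 < N)%N ->
  exists (P : 'M[R]_n.+1) (lam : 'rV[R]_n.+1),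
    [/\ P \in unitmx, P *m A = diag_mx lam *m P,
        forall i, lam 0 i != 0
      & forall i j : 'I_n.+1, (i < j)%N -> `|lam 0 j| < `|lam 0 i|].
Proof.
move=> B0 oddN N0; have [r ru chi] := minors_gt0_real_spectrum B0.
have AB : A *m A ^+ N = A ^+ N *m A.
  by rewrite -[LHS]exprS -[RHS]exprSr.
have [P [d [d' [Pu PA PB d'I]]]] := commuting_diagonalization ru chi AB.
have d'E i : d' 0 i = d 0 i ^+ N.
  have := simmxX N PA; rewrite PB diag_mxX => /(can_inj (mulmxK Pu)).
  by move=> /matrixP/(_ i i); rewrite !mxE eqxx !mulr1n.
have dI : injective (fun i => - `|d 0 i|).
  move=> i j /oppr_inj dij; apply: d'I; rewrite !d'E.
  have evenX (x : R) : x ^+ N = `|x| ^+ N.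
    by rewrite -normrX ger0_norm // exprn_even_ge0.
  by rewrite evenX dij -evenX.
have d0 i : d 0 i != 0.
  have detB : \det (A ^+ N) != 0.
    have := B0 _ id id (fun _ _ => id) (fun _ _ => id).
    by rewrite /minor mxsub_id => /gt_eqF ->.
  have : \det (diag_mx d') != 0.
    have /(congr1 determinant) := PB; rewrite !det_mulmx => E.
    apply: contra_neq detB => D0; move: E; rewrite D0 mul0r => /eqP.
    rewrite mulf_eq0 => /orP[|/eqP //].
    by move: Pu; rewrite unitmxE unitfE => /negbTE ->.
  rewrite det_diag => /prodf_neq0/(_ i isT); rewrite d'E.
  by rewrite expf_eq0 N0.
have [s sP] := sort_injective dI.
exists (row_perm s P), (\row_i d 0 (s i)); split.
- by rewrite row_permE unitmx_mul unitmx_perm.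
- have -> : row_perm s P *m A = row_perm s (P *m A).
    by rewrite !row_permE mulmxA.
  rewrite PA; apply/matrixP => i j.
  by rewrite mxE !mul_diag_mx !mxE.
- by move=> i; rewrite mxE.
- by move=> i j /sP; rewrite !mxE ltrN2.
Qed.

(** * Signs of the products of leading eigenvalues *)

Lemma geometric_small (R : archiRealFieldType) (q e : R) :
  0 <= q < 1 -> 0 < e ->
  exists M, forall m, (M <= m)%N -> q ^+ m < e.
Proof.
move=> /andP[q0 q1] e0; have [->|qN0] := eqVneq q 0.
  by exists 1%N => -[//|m] _; rewrite expr0n.
have {q0 qN0} q0 : 0 < q by rewrite lt_neqAle eq_sym qN0.
pose x := q^-1 - 1; have x0 : 0 < x by rewrite subr_gt0 invf_gt1.
have bernoulli m : 1 + m%:R * x <= (q^-1) ^+ m.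
  elim: m => [|m IH]; first by rewrite mul0r addr0.
  have m0 : 0 <= m%:R :> R := ler0n _ _.
  rewrite exprS; have -> : q^-1 = 1 + x by rewrite addrC subrK.
  have : (1 + x) * (1 + m%:R * x) <= (1 + x) * (1 + x) ^+ m.
    by rewrite ler_pM2l; [rewrite (_ : 1 + x = q^-1) // addrC subrK|lra].
  apply: le_trans; rewrite -natr1; nra.
have [M HM] : exists M : nat, (e * x)^-1 < M%:R.
  by exists (Num.bound (e * x)^-1); apply: archi_boundP; rewrite invr_ge0 mulr_ge0 // ltW.
exists M => m Mm; rewrite -[q ^+ m]invrK -exprVn.
rewrite invf_plt ?posrE ?exprn_gt0 ?invr_gt0 //.
apply: lt_le_trans (bernoulli m).
have : (e * x)^-1 * x < M%:R * x by rewrite ltr_pM2r.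
rewrite invfM mulfVK ?gt_eqF // => /lt_trans; apply.
have : M%:R * x <= m%:R * x by rewrite ler_pM2r // ler_nat.
lra.
Qed.

(* For large odd [m] the term [t ^+ m] outweighs all the smaller ones. *)
Lemma dominant_power_sum_gt0 (R : archiRealFieldType) (I : finType)
    (w : I -> R) (t e : R) (i0 : I) :
  w i0 = t -> t != 0 -> e ^+ 2 = 1 ->
  (forall i, w i = t \/ `|w i| < `|t|) ->
  (forall m, (0 < m)%N -> 0 <= e ^+ m * \sum_i w i ^+ m) ->
  0 < e * t.
Proof.
move=> wi0 t0 e2 wt pos; rewrite ltNge; apply/negP => et.
have e0 : e != 0.
  by apply: contra_eq_neq e2 => ->; rewrite expr0n eq_sym oner_eq0.
have norme : `|e| = 1.
  by apply/eqP; rewrite -sqrp_eq1 // -normrX e2 normr1.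
have nt : e * t = - `|t|.
  by rewrite -[`|t|]mul1r -norme -normrM ler0_norm ?opprK.
have at0 : 0 < `|t| by rewrite normr_gt0.
(* Normalized so that, were the claim false, the dominant terms would all equal -1 and the others
   have modulus below 1. *)
pose v i := e * w i / `|t|.
have vP i : v i = -1 \/ `|v i| < 1.
  case: (wt i) => [wi|wi]; [left|right].
    by rewrite /v wi nt mulNr divff ?gt_eqF.
  by rewrite /v !normrM norme mul1r normfV normr_id ltr_pdivrMr ?mul1r.
have vi0 : v i0 = -1 by rewrite /v wi0 nt mulNr divff ?gt_eqF.
(* Small enough for all the terms other than [i0] to add up to less than 1, against the -1 of
   [i0]. *)
pose eps : R := (#|I|.+1%:R)^-1.
have eps0 : 0 < eps by rewrite invr_gt0 ltr0n.
have small i : exists M, forall m, (M <= m)%N -> odd m -> v i ^+ m <= eps.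
  case: (vP i) => [->|vi].
    by exists 0%N => m _ om; rewrite -signr_odd om expr1; lra.
  have [|M HM] := @geometric_small R `|v i| eps _ eps0.
    by rewrite normr_ge0.
  exists M => m Mm _; apply: le_trans (ler_norm _) _.
  by rewrite normrX ltW ?HM.
have [M HM] := fin_all_exists small.
pose m := (\max_i M i).*2.+1.
have om : odd m by rewrite /m /= odd_double.
have Mm i : (M i <= m)%N.
  by rewrite /m (leq_trans (leq_bigmax i)) // -addnn -addnS leq_addr.
have : 0 <= \sum_i v i ^+ m.
  have -> : \sum_i v i ^+ m = e ^+ m * (\sum_i w i ^+ m) / `|t| ^+ m.
    rewrite mulr_sumr mulr_suml; apply: eq_bigr => i _.
    by rewrite /v !exprMn exprVn.
  by rewrite divr_ge0 ?pos // exprn_ge0.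
apply/negP; rewrite -ltNge (bigD1 i0) //= vi0 -signr_odd om expr1.
have : \sum_(i | i != i0) v i ^+ m <= \sum_(i : I) eps.
  rewrite [leRHS](bigD1 i0) //=; apply: ler_wpDl; first exact: ltW.
  by apply: ler_sum => i _; apply: HM.
rewrite sumr_const -mulr_natl => S.
have : #|I|%:R * eps < 1.
  by rewrite ltr_pdivrMr ?ltr0n // mul1r ltr_nat.
by move: S; rewrite -[#|I|]/(#|{: I}|); lra.
Qed.

(** This is [k!] times the sum of the principal minors of order [k]: a map that is not injective
    contributes 0, and reordering [f] changes the sign of the minor twice. *)
Definition trace_minors (R : realFieldType) (n k : nat) (A : 'M[R]_n) : R :=
  \sum_(f : {ffun 'I_k -> 'I_n}) minor A f f.

(** By Cauchy-Binet both sides are the same double sum up to a factor [k!]. Invariance under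
    similarity follows. *)
Lemma trace_minors_mulC (R : realFieldType) (n k : nat) (A B : 'M[R]_n) :
  trace_minors k (A *m B) = trace_minors k (B *m A).
Proof.
have k0 : k`!%:R != 0 :> R by rewrite pnatr_eq0 -lt0n fact_gt0.
apply: (mulfI k0); rewrite !mulr_sumr.
under eq_bigr => f _ do rewrite minor_mul.
under [RHS]eq_bigr => f _ do rewrite minor_mul.
rewrite exchange_big; apply: eq_bigr => f _; apply: eq_bigr => g _.
exact: mulrC.
Qed.

Lemma trace_minors_diag (R : realFieldType) (n k : nat) (d : 'rV[R]_n) :
  trace_minors k (diag_mx d) =
  \sum_(f : {ffun 'I_k -> 'I_n})
    if injectiveb f then \prod_i d 0 (f i) else 0.
Proof.
apply: eq_bigr => f _; case: ifPn => [/injectiveP fI|]; last first.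
  exact: minor_not_injr.
rewrite /minor (_ : mxsub _ _ _ = diag_mx (\row_i d 0 (f i))).
  by rewrite det_diag; apply: eq_bigr => i _; rewrite mxE.
by apply/matrixP => i j; rewrite !mxE (inj_eq fI).
Qed.

Lemma trace_minors_ge0 (R : realFieldType) (n k : nat) (e : R)
    (A : 'M[R]_n) : minors_ge0 k e A -> 0 <= e * trace_minors k A.
Proof.
move=> A0; rewrite mulr_sumr; apply: sumr_ge0 => f _.
case: (boolP (injectiveb f)) => [/injectiveP fI|nI]; last first.
  by rewrite minor_not_injr // mulr0.
have [g [s [gi fg]]] := increasing_perm fI.
rewrite (eq_minor A fg fg) minor_comp_perml minor_comp_permr mulrA -expr2.
by rewrite sqrr_sign mul1r A0.
Qed.

(** Once sorted, [f] satisfies [i <= f i], so the moduli compare factor by factor, strictly as soon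
    as one index differs. *)
Lemma prod_lead_dominates (R : realFieldType) (n k : nat) (kn : (k <= n)%N)
    (lam : 'I_n -> R) (f : 'I_k -> 'I_n) :
  (forall i, lam i != 0) ->
  (forall i j : 'I_n, (i < j)%N -> `|lam j| < `|lam i|) ->
  injective f ->
  \prod_i lam (f i) = \prod_i lam (widen_ord kn i) \/
  `|\prod_i lam (f i)| < `|\prod_i lam (widen_ord kn i)|.
Proof.
move=> lam0 lam_dec fI; have [g [s [gi fg]]] := increasing_perm fI.
have -> : \prod_i lam (f i) = \prod_i lam (g i).
  rewrite [RHS](reindex_inj (@perm_inj _ s)).
  by apply: eq_bigr => i _; rewrite fg.
have gle i : `|lam (g i)| <= `|lam (widen_ord kn i)|.
  have := increasing_ge i gi; rewrite leq_eqVlt.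
  case/predU1P => [e|igi]; last exact/ltW/lam_dec.
  by rewrite (_ : g i = widen_ord kn i) //; apply: val_inj.
case: (boolP [forall i, g i == widen_ord kn i]) => [/forallP gw|].
  by left; apply: eq_bigr => i _; rewrite (eqP (gw i)).
case/forallPn => i gwi; right.
rewrite !normr_prod (bigD1 i) //= [ltRHS](bigD1 i) //=.
have rest : \prod_(j | j != i) `|lam (g j)| <=
    \prod_(j | j != i) `|lam (widen_ord kn j)|.
  by apply: ler_prod => j _; rewrite normr_ge0 gle.
apply: le_lt_trans (ler_wpM2l (normr_ge0 _) rest) _.
rewrite ltr_pM2r; last by apply: prodr_gt0 => j _; rewrite normr_gt0.
apply: lam_dec; rewrite ltn_neqAle (increasing_ge i gi) andbT.
by move: gwi; rewrite -val_eqE eq_sym.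
Qed.

Lemma rev_signS (R : realFieldType) (k : nat) :
  rev_sign R k.+1 = (-1) ^+ k * rev_sign R k.
Proof.
have E m : rev_sign R m = (-1) ^+ 'C(m, 2).
  by rewrite /rev_sign subn1 divn2 -bin2.
by rewrite !E binS bin1 exprD mulrC.
Qed.

Lemma lead_product_sign (R : realType) (n : nat) (A P : 'M[R]_n.+1)
    (lam : 'rV[R]_n.+1) :
  (forall k, minors_ge0 k (rev_sign R k) A) ->
  P \in unitmx -> P *m A = diag_mx lam *m P ->
  (forall i, lam 0 i != 0) ->
  (forall i j : 'I_n.+1, (i < j)%N -> `|lam 0 j| < `|lam 0 i|) ->
  forall k (kn : (k <= n.+1)%N),
    0 < rev_sign R k * \prod_(i < k) lam 0 (widen_ord kn i).
Proof.
move=> A0 Pu PA lam0 lam_dec k kn.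
(* The value 0 for maps that are not injective matches their zero minors; its powers vanish because
   only exponents [m > 0] occur. *)
pose w (f : {ffun 'I_k -> 'I_n.+1}) :=
  if injectiveb f then \prod_i lam 0 (f i) else 0.
have t0 : \prod_(i < k) lam 0 (widen_ord kn i) != 0.
  by apply/prodf_neq0 => i _.
apply: (@dominant_power_sum_gt0 _ _ w _ _ (finfun (widen_ord kn))) => //.
- rewrite /w (_ : injectiveb _ = true).
    by apply: eq_bigr => i _; rewrite ffunE.
  apply/injectiveP => i j; rewrite !ffunE => /(congr1 val) /= ij.
  exact: val_inj.
- by rewrite expr2 rev_sign_mul.
- move=> f; rewrite /w; case: ifPn => [/injectiveP fI|_].
    exact: prod_lead_dominates.
  by right; rewrite normr0 normr_gt0.
move=> m m0; have := trace_minors_ge0 (minors_ge0_exp m (A0 k)).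
have -> : A ^+ m = invmx P *m (diag_mx lam ^+ m *m P).
  by rewrite -(simmxX m PA) mulKmx.
rewrite trace_minors_mulC mulmxK // diag_mxX trace_minors_diag.
congr (0 <= _ * _); apply: eq_bigr => f _; rewrite /w.
case: ifP => _; last by rewrite expr0n (gtn_eqF m0).
by rewrite -prodrXl; apply: eq_bigr => i _; rewrite mxE.
Qed.

Lemma self_interlacing_of_sign_regular (R : realType) (n N : nat)
    (A : 'M[R]_n.+1) :
  (forall k, minors_ge0 k (rev_sign R k) A) ->
  (forall k (f g : 'I_k -> 'I_n.+1), increasing f -> increasing g ->
     0 < minor (A ^+ N) f g) ->
  ~~ odd N -> (0 < N)%N -> self_interlacing_spectrum A.
Proof.
move=> A0 AN0 oddN N0.
have [P [lam [Pu PA lam0 lam_dec]]] := ordered_diagonalization AN0 oddN N0.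
have lead := lead_product_sign A0 Pu PA lam0 lam_dec.
have lam_sign (i : 'I_n.+1) : 0 < (-1) ^+ i * lam 0 i.
  have i_le := ltnW (ltn_ord i).
  have t0 : 0 < (\prod_(j < i) lam 0 (widen_ord i_le j)) ^+ 2.
    by rewrite exprn_even_gt0 //=; apply/prodf_neq0 => j _.
  rewrite -(pmulr_lgt0 _ t0).
  (* Multiplying the sign conditions of orders [i] and [i.+1] squares the common product [t] and
     isolates the factor [(-1) ^+ i * lam 0 i]. *)
  have := mulr_gt0 (lead _ i_le) (lead _ (ltn_ord i)).
  rewrite big_ord_recr /= rev_signS.
  have -> : widen_ord (ltn_ord i) ord_max = i by apply: val_inj.
  have -> : \prod_(j < i) lam 0 (widen_ord (ltn_ord i) (widen_ord (leqnSn i) j))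
      = \prod_(j < i) lam 0 (widen_ord i_le j).
    by apply: eq_bigr => j _; congr (lam 0 _); apply: val_inj.
  congr (0 < _); have := rev_sign_mul R i.
  set s := rev_sign R i; set t := \prod_(j < i) _; set u := (-1) ^+ i => ss.
  by transitivity (s * s * (u * lam 0 i * t ^+ 2)); [ring|rewrite ss mul1r].
have lam_abs (i : 'I_n.+1) : (-1) ^+ i * lam 0 i = `|lam 0 i|.
  by rewrite -[LHS]gtr0_norm // normrMsign.
exists (lam 0); split=> //.
- by rewrite (char_poly_simmx Pu PA) char_poly_diag.
- move=> i j lij; apply: val_inj.
  by case: (ltngtP i j) => // /lam_dec; rewrite lij ltxx.
- by move=> i j ij; rewrite !lam_abs lam_dec.
Qed.

Theorem theorem2p14 (R : realType) (n : nat) (hn : (1 <= n)%N)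
    (a b c : nat -> R)
    (habc : forall j : nat, (1 <= j <= n - 1)%N ->
      [/\ 0 < a j, 0 < b j & 0 < c j]) :
  (sign_definite_plus (anti_tridiagonal n a b c) /\
   self_interlacing_spectrum (anti_tridiagonal n a b c)) <->
  (forall k : nat, (1 <= k <= n)%N ->
     0 < (-1) ^+ (k * (k - 1) %/ 2) * \det (anti_tridiagonal k a b c)).
Proof.
split=> [[[sdA _] sis] k /andP[_ kn]|D0].
  rewrite det_anti_tridiagonal mulrA rev_sign_mul mul1r.
  (* Only the full determinant is left, and the self-interlacing spectrum determines its sign. *)
  apply: (det_tridiagonal_gt0 habc sdA) => //.
  have := self_interlacing_det sis.
  by rewrite det_anti_tridiagonal mulrA rev_sign_mul mul1r.
have [L [U [HL HU TLU]]] : exists L U : 'M[R]_n, [/\ upper_bidiagonal_gt0 L^T,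
    upper_bidiagonal_gt0 U & tridiagonal n a b c = L *m U].
  apply: tridiagonal_LU => [j /habc[]//|[|k] kn].
    by rewrite det_tridiagonal0.
  have := D0 k.+1 kn.
  by rewrite det_anti_tridiagonal mulrA rev_sign_mul mul1r.
have minors0 k : minors_ge0 k (rev_sign R k) (anti_tridiagonal n a b c).
  by rewrite anti_tridiagonalE TLU; apply: minors_ge0_revLU.
have minors_exp k (f g : 'I_k -> 'I_n) : increasing f -> increasing g ->
    0 < minor (anti_tridiagonal n a b c ^+ (4 * n)) f g.
  by rewrite anti_tridiagonalE TLU; apply: minor_exp_gt0.
have n4 : (0 < 4 * n)%N by rewrite muln_gt0.
split.
  split; first exact: sign_definite_of_minors_ge0.
  exists (4 * n)%N; split=> //.
  exact: strictly_sign_definite_of_minors_gt0.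
case: n hn habc D0 L U HL HU TLU minors0 minors_exp n4 => // n _ _ _ _ _ _ _ _.
move=> minors0 minors_exp n4.
apply: (self_interlacing_of_sign_regular minors0 minors_exp) => //.
by rewrite oddM.
Qed.
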